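(* Let $\mathbb{F}$ be a field of characteristic zero and let $W_2$ be the 6-dimensional $\mathbb{F}$-algebra with basis $e_1,\dots,e_6$ defined in the context. If $I$ is a non-trivial left ideal of $W_2$, then $I$ is one of the following subspaces (where $\langle\cdot\rangle$ denotes $\mathbb{F}$-linear span): 1) $\langle e_1,e_2,e_3,e_4\rangle$; 2) $\langle e_5,e_6\rangle$.
   Context: Let $V_2$ be a 2-dimensional vector space over $\mathbb{F}$ with basis $v_1,v_2$. $W(2)$ is the vector space of all bilinear maps $V_2\times V_2\to V_2$ with the (not necessarily associative, not necessarily unital) product $$(A\cdot B)(x,y)=A(v_1,B(x,y))-B(A(v_1,x),y)-B(x,A(v_1,y)),\qquad x,y\in V_2.$$ For $i,j,k\in\{1,2\}$ let $\alpha_{ij}^k\in W(2)$ be given by $\alpha_{ij}^k(v_t,v_l)=\delta_{it}\delta_{jl}v_k$. Put $e_1=\alpha_{11}^1-\alpha_{12}^2-\alpha_{21}^2$, $e_2=\alpha_{11}^2$, $e_3=\alpha_{22}^2-\alpha_{12}^1-\alpha_{21}^1$, $e_4=\alpha_{22}^1$, $e_5=2\alpha_{11}^1+\alpha_{12}^2+\alpha_{21}^2$, $e_6=2\alpha_{22}^2+\alpha_{12}^1+\alpha_{21}^1$. $W_2$ is the subalgebra of $W(2)$ with basis $e_1,\dots,e_6$ (it consists of all commutative, i.e. symmetric, bilinear maps). A left ideal of an algebra $W$ is a subspace $I$ with $WI\subseteq I$; it is non-trivial if $I\neq 0$ and $I\neq W$. *)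

(* Defs.v *)
From HB Require Import structures.
From mathcomp Require Import all_boot all_order all_algebra.

Set Implicit Arguments.
Unset Strict Implicit.
Unset Printing Implicit Defensive.

Import GRing.Theory.
Local Open Scope ring_scope.

Section BilinearMaps.

Variables (F : fieldType) (V : vectType F).

(* Bilinear maps V x V -> V in curried form: A x y is the value at (x, y). *)
Definition bilmap := 'Hom(V, 'Hom(V, V)).

(* [linfun] returns an unspecified linear map on non-linear input; [bilfunE]
   shows that [bilfun f] is f for every bilinear f. *)
Definition bilfun (f : V -> V -> V) : bilmap :=
  linfun (fun x => linfun (f x)).

Lemma bilfunE (f : V -> V -> V) (x y : V) :
  (forall u, linear (f u)) -> (forall u, linear (f^~ u)) ->
  bilfun f x y = f x y.
Proof.
move=> f_linr f_linl.
pose fr u := GRing.isLinear.Build F V V _ (f u) (f_linr u).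
pose Fr u : {linear V -> V} := HB.pack (f u) (fr u).
have frE u z : linfun (f u) z = f u z by exact: (lfunE (Fr u)).
have lin2 : linear (fun u => linfun (f u)).
  move=> a u w; apply/lfunP => z.
  by rewrite add_lfunE scale_lfunE !frE f_linl.
pose fl := GRing.isLinear.Build F V 'Hom(V, V) _ _ lin2.
pose Fl : {linear V -> 'Hom(V, V)} := HB.pack (fun u => linfun (f u)) fl.
by rewrite /bilfun (lfunE Fl) /= frE.
Qed.

Variable v : 2.-tuple V.

(* Indices are shifted: the basis v_1, v_2 is v`_0, v`_1. *)
Definition bilmul (A B : bilmap) : bilmap :=
  bilfun (fun x y => A v`_0 (B x y) - B (A v`_0 x) y - B x (A v`_0 y)).

Lemma bilmulE (A B : bilmap) (x y : V) :
  bilmul A B x y = A v`_0 (B x y) - B (A v`_0 x) y - B x (A v`_0 y).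
Proof.
rewrite /bilmul bilfunE // => u a s t.
- by rewrite !linearP /= !scalerDr [RHS]addrACA [X in _ = X + _]addrACA.
- rewrite !linearP /= !(add_lfunE, scale_lfunE) !linearP /=.
  by rewrite !scalerDr [RHS]addrACA [X in _ = X + _]addrACA.
Qed.

Definition alpha (i j k : 'I_2) : bilmap :=
  bilfun (fun x y => (coord v i x * coord v j y) *: v`_k).

Lemma alphaE (i j k t l : 'I_2) : basis_of fullv v ->
  alpha i j k v`_t v`_l = ((i == t) && (j == l))%:R *: v`_k.
Proof.
move=> /basis_free v_free; rewrite /alpha bilfunE => [|u a s w|u a s w].
- by rewrite !coord_free // -natrM mulnb eq_sym [l == j]eq_sym.
- by rewrite linearP /= mulrDr mulrCA scalerDl scalerA.
- by rewrite linearP /= mulrDl -mulrA scalerDl scalerA.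
Qed.

Definition e1 : bilmap := alpha 0 0 0 - alpha 0 1 1 - alpha 1 0 1.
Definition e2 : bilmap := alpha 0 0 1.
Definition e3 : bilmap := alpha 1 1 1 - alpha 0 1 0 - alpha 1 0 0.
Definition e4 : bilmap := alpha 1 1 0.
Definition e5 : bilmap := 2 *: alpha 0 0 0 + alpha 0 1 1 + alpha 1 0 1.
Definition e6 : bilmap := 2 *: alpha 1 1 1 + alpha 0 1 0 + alpha 1 0 0.

Definition W2 : {vspace bilmap} := <<[:: e1; e2; e3; e4; e5; e6]>>%VS.

Definition left_ideal (W I : {vspace bilmap}) : Prop :=
  (I <= W)%VS /\ {in W & I, forall A B, bilmul A B \in I}.

Definition nontrivial_left_ideal (W I : {vspace bilmap}) : Prop :=
  [/\ left_ideal W I, I <> 0%VS & I <> W].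

End BilinearMaps.

(* Main.v *)
(** The product [A . B] depends on [A] only through the endomorphism
    [A(v_1, -)], which acts on [B] as a derivation; for [A] in [W2] this
    endomorphism is arbitrary.  Hence left ideals of [W2] are the
    gl(V)-submodules of S^2 V^* (x) V, the sum of the traceless part
    [<e1, .., e4>] and a copy [<e5, e6>] of V^*.  Weight projections followed by
    raising and lowering operators show that every element of a left ideal [I]
    with a nonzero coordinate along the first (second) summand forces
    [e2] ([e5]) into [I], and each of these vectors generates its summand. *)
Require Import Defs.
From mathcomp Require Import all_boot all_order all_algebra.
From mathcomp Require Import ring.

Import GRing.Theory.
Local Open Scope ring_scope.

Section PlaneBilinearMaps.

Variables (F : fieldType) (V : vectType F) (v : 2.-tuple V).
Hypothesis v_basis : basis_of fullv v.

(** * Coordinates on [V] and values on basis vectors *)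

Definition vcomb (a b : F) : V := a *: v`_0 + b *: v`_1.

Lemma vcombD a b c d : vcomb a b + vcomb c d = vcomb (a + c) (b + d).
Proof. by rewrite /vcomb !scalerDl addrACA. Qed.

Lemma vcombZ k a b : k *: vcomb a b = vcomb (k * a) (k * b).
Proof. by rewrite /vcomb scalerDr !scalerA. Qed.

Lemma vcombB a b c d : vcomb a b - vcomb c d = vcomb (a - c) (b - d).
Proof. by rewrite -scaleN1r vcombZ vcombD !mulN1r. Qed.

Lemma bilmap_vcombr (A : bilmap V) x a b :
  A x (vcomb a b) = a *: A x v`_0 + b *: A x v`_1.
Proof. by rewrite linearD !linearZ. Qed.

Lemma bilmap_vcombl (A : bilmap V) y a b :
  A (vcomb a b) y = a *: A v`_0 y + b *: A v`_1 y.
Proof. by rewrite linearD !linearZ !(add_lfunE, scale_lfunE). Qed.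

Lemma vcomb_surj x : {a & {b | x = vcomb a b}}.
Proof.
exists (coord v ord0 x), (coord v (lift ord0 ord0) x).
by rewrite {1}(coord_basis v_basis (memvf x)) !big_ord_recl big_ord0 addr0.
Qed.

Lemma bilmap_eq (A B : bilmap V) :
    A v`_0 v`_0 = B v`_0 v`_0 -> A v`_0 v`_1 = B v`_0 v`_1 ->
    A v`_1 v`_0 = B v`_1 v`_0 -> A v`_1 v`_1 = B v`_1 v`_1 ->
  A = B.
Proof.
move=> AB00 AB01 AB10 AB11; apply/lfunP => x; apply/lfunP => y.
have [a [b ->]] := vcomb_surj x; have [c [d ->]] := vcomb_surj y.
by rewrite !(bilmap_vcombl, bilmap_vcombr) AB00 AB01 AB10 AB11.
Qed.

(** * Coordinates on [W2] and its product *)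

Definition W2comb (c1 c2 c3 c4 c5 c6 : F) : bilmap V :=
  c1 *: e1 v + (c2 *: e2 v + (c3 *: e3 v + (c4 *: e4 v
    + (c5 *: e5 v + c6 *: e6 v)))).

Lemma W2combD a1 a2 a3 a4 a5 a6 b1 b2 b3 b4 b5 b6 :
  W2comb a1 a2 a3 a4 a5 a6 + W2comb b1 b2 b3 b4 b5 b6
  = W2comb (a1 + b1) (a2 + b2) (a3 + b3) (a4 + b4) (a5 + b5) (a6 + b6).
Proof. by rewrite /W2comb !scalerDl; do 5![rewrite addrACA; congr (_ + _)]. Qed.

Lemma W2combZ k c1 c2 c3 c4 c5 c6 :
  k *: W2comb c1 c2 c3 c4 c5 c6
  = W2comb (k * c1) (k * c2) (k * c3) (k * c4) (k * c5) (k * c6).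
Proof. by rewrite /W2comb !scalerDr !scalerA. Qed.

Lemma W2comb_in c1 c2 c3 c4 c5 c6 : W2comb c1 c2 c3 c4 c5 c6 \in W2 v.
Proof.
by rewrite /W2comb; repeat apply: memvD; apply: memvZ; apply: memv_span;
  rewrite !inE eqxx ?orbT.
Qed.

Lemma W2_inP w : w \in W2 v ->
  exists c1 c2 c3 c4 c5 c6, w = W2comb c1 c2 c3 c4 c5 c6.
Proof.
rewrite /W2 !span_cons span_nil addv0.
case/memv_addP => _ /vlineP[c1 ->] [w1 + ->].
case/memv_addP => _ /vlineP[c2 ->] [w2 + ->].
case/memv_addP => _ /vlineP[c3 ->] [w3 + ->].
case/memv_addP => _ /vlineP[c4 ->] [w4 + ->].
case/memv_addP => _ /vlineP[c5 ->] [_ /vlineP[c6 ->] ->].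
by exists c1, c2, c3, c4, c5, c6.
Qed.

Lemma alpha_vcomb i j k (t l : 'I_2) : alpha v i j k v`_t v`_l =
  vcomb (((i == t) && (j == l))%:R * (k == 0)%:R)
        (((i == t) && (j == l))%:R * (k == 1)%:R).
Proof.
rewrite alphaE // -vcombZ; congr (_ *: _); rewrite /vcomb.
by case: k => [[|[|]]] //= ?; rewrite scale1r scale0r ?addr0 ?add0r.
Qed.

Lemma W2combE c1 c2 c3 c4 c5 c6 (t l : 'I_2) :
  W2comb c1 c2 c3 c4 c5 c6 v`_t v`_l =
  if t == 0 then if l == 0 then vcomb (c1 + 2 * c5) c2
                 else vcomb (c6 - c3) (c5 - c1)
  else if l == 0 then vcomb (c6 - c3) (c5 - c1)
       else vcomb c4 (c3 + 2 * c6).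
Proof.
rewrite /W2comb /e1 /e2 /e3 /e4 /e5 /e6.
rewrite !(add_lfunE, opp_lfunE, scale_lfunE) !alpha_vcomb.
rewrite !(vcombZ, vcombB, vcombD).
by case: t => [[|[|]]] //= ?; case: l => [[|[|]]] //= ?;
  congr vcomb; rewrite /=; ring.
Qed.

(** The scalars [p, q] and [r, s] are the coordinates of the images of [v_1] and [v_2] under the
    endomorphism [A(v_1, -)]. No term mixes [c1, .., c4] with [c5, c6], so both summands are
    stable. *)
Lemma bilmul_W2comb (a1 a2 a3 a4 a5 a6 c1 c2 c3 c4 c5 c6 : F) :
  let p := a1 + 2 * a5 in let q := a2 in
  let r := a6 - a3 in let s := a5 - a1 in
  bilmul v (W2comb a1 a2 a3 a4 a5 a6) (W2comb c1 c2 c3 c4 c5 c6) =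
  W2comb (2 * q * c3 - p * c1 + r * c2) (3 * q * c1 + (s - 2 * p) * c2)
         (2 * r * c1 - s * c3 + q * c4) (3 * r * c3 + (p - 2 * s) * c4)
         (- p * c5 - q * c6) (- r * c5 - s * c6).
Proof.
rewrite /=; set C := (X in _ = X).
set A := W2comb a1 _ _ _ _ _; set B := W2comb c1 _ _ _ _ _.
have A00 : A v`_0 v`_0 = _ := W2combE _ _ _ _ _ _ 0 0.
have A01 : A v`_0 v`_1 = _ := W2combE _ _ _ _ _ _ 0 1.
have B00 : B v`_0 v`_0 = _ := W2combE _ _ _ _ _ _ 0 0.
have B01 : B v`_0 v`_1 = _ := W2combE _ _ _ _ _ _ 0 1.
have B10 : B v`_1 v`_0 = _ := W2combE _ _ _ _ _ _ 1 0.
have B11 : B v`_1 v`_1 = _ := W2combE _ _ _ _ _ _ 1 1.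
have C00 : C v`_0 v`_0 = _ := W2combE _ _ _ _ _ _ 0 0.
have C01 : C v`_0 v`_1 = _ := W2combE _ _ _ _ _ _ 0 1.
have C10 : C v`_1 v`_0 = _ := W2combE _ _ _ _ _ _ 1 0.
have C11 : C v`_1 v`_1 = _ := W2combE _ _ _ _ _ _ 1 1.
rewrite /= in A00 A01 B00 B01 B10 B11 C00 C01 C10 C11.
(* Only the values on basis vectors matter now, so the bodies of [A], [B], [C] are dropped. *)
move: A B C A00 A01 B00 B01 B10 B11 C00 C01 C10 C11 => A B C.
move=> A00 A01 B00 B01 B10 B11 C00 C01 C10 C11.
by apply: bilmap_eq; rewrite bilmulE ?(A00, A01) !(B00, B01, B10, B11)
  !(C00, C01, C10, C11) !bilmap_vcombr !bilmap_vcombl !(A00, A01)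
  !(B00, B01, B10, B11) !(vcombZ, vcombD, vcombB); congr vcomb; ring.
Qed.

(** * The action of gl(V) on a left ideal *)

Section LeftIdeal.

Variable I : {vspace bilmap V}.
Hypothesis charF0 : [pchar F] =i pred0.
Hypothesis I_ideal : left_ideal v (W2 v) I.

(** Reduces a change of coordinates to six scalar equations, within reach of [ring] and [field]. *)
Lemma W2comb_in_eq {a1 a2 a3 a4 a5 a6} b1 b2 b3 b4 b5 b6 :
    W2comb a1 a2 a3 a4 a5 a6 \in I ->
    a1 = b1 -> a2 = b2 -> a3 = b3 -> a4 = b4 -> a5 = b5 -> a6 = b6 ->
  W2comb b1 b2 b3 b4 b5 b6 \in I.
Proof. by move=> + <- <- <- <- <- <-. Qed.

Let two_neq0 : 2 != 0 :> F. Proof. by rewrite ((pcharf0P F).1 charF0). Qed.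
Let three_neq0 : 3 != 0 :> F. Proof. by rewrite ((pcharf0P F).1 charF0). Qed.
Let six_neq0 : 6 != 0 :> F. Proof. by rewrite ((pcharf0P F).1 charF0). Qed.

Section Operators.

Context {c1 c2 c3 c4 c5 c6 : F}.
Hypothesis cI : W2comb c1 c2 c3 c4 c5 c6 \in I.

Let bilmul_in a1 a2 a3 a4 a5 a6 :
  bilmul v (W2comb a1 a2 a3 a4 a5 a6) (W2comb c1 c2 c3 c4 c5 c6) \in I.
Proof. by apply: I_ideal.2 => //; apply: W2comb_in. Qed.

(* The action of the elementary matrix sending v_1 to v_2. *)
Lemma lower_in : W2comb (2 * c3) (3 * c1) c4 0 (- c6) 0 \in I.
Proof.
have := bilmul_in 0 1 0 0 0 0; rewrite bilmul_W2comb.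
by move/W2comb_in_eq; apply; ring.
Qed.

(* The action of the elementary matrix sending v_2 to v_1. *)
Lemma raise_in : W2comb c2 0 (2 * c1) (3 * c3) 0 (- c5) \in I.
Proof.
(* The left factor [e6 - 2 e3] has [r = 3] and [p = q = s = 0]. *)
have := memvZ 3^-1 (bilmul_in 0 0 (- 2) 0 0 1); rewrite bilmul_W2comb W2combZ.
by move/W2comb_in_eq; apply; field.
Qed.

(* The action of the elementary matrix fixing v_1 and killing v_2. *)
Lemma weight_in : W2comb (- c1) (- 2 * c2) 0 c4 (- c5) 0 \in I.
Proof.
(* The left factor [e1 + e5] has [p = 3] and [q = r = s = 0]. *)
have := memvZ 3^-1 (bilmul_in 1 0 0 0 1 0); rewrite bilmul_W2comb W2combZ.
by move/W2comb_in_eq; apply; field.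
Qed.

End Operators.

(** * Projections onto the weight spaces *)

Section WeightProjections.

Context {c1 c2 c3 c4 c5 c6 : F}.
Hypothesis cI : W2comb c1 c2 c3 c4 c5 c6 \in I.

Let w1 := weight_in cI.
Let w2 := weight_in w1.
Let w3 := weight_in w2.

(* The combinations below are the Lagrange interpolation polynomials at the
   weights -2, -1, 0, 1, evaluated at the operator of [weight_in]. *)
Lemma proj2_in : W2comb 0 c2 0 0 0 0 \in I.
Proof.
have := memvD (memvZ 6^-1 w1) (memvZ (- 6^-1) w3).
by rewrite !W2combZ W2combD => /W2comb_in_eq; apply; field;
  rewrite ?six_neq0 ?two_neq0 ?three_neq0.
Qed.

Lemma proj15_in : W2comb c1 0 0 0 c5 0 \in I.
Proof.
have := memvD (memvD (memvZ (- 1) w1) (memvZ 2^-1 w2)) (memvZ 2^-1 w3).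
by rewrite !W2combZ !W2combD => /W2comb_in_eq; apply; field.
Qed.

Lemma proj4_in : W2comb 0 0 0 c4 0 0 \in I.
Proof.
have := memvD (memvD (memvZ 3^-1 w1) (memvZ 2^-1 w2)) (memvZ 6^-1 w3).
by rewrite !W2combZ !W2combD => /W2comb_in_eq; apply; field;
  rewrite ?six_neq0 ?two_neq0 ?three_neq0.
Qed.

Lemma proj36_in : W2comb 0 0 c3 0 0 c6 \in I.
Proof.
(* The four projections sum to the identity, which leaves the weight 0 part. *)
have := memvD (memvD cI (memvZ (- 1) proj2_in))
  (memvD (memvZ (- 1) proj15_in) (memvZ (- 1) proj4_in)).
by rewrite !W2combZ !W2combD => /W2comb_in_eq; apply; ring.
Qed.

End WeightProjections.

(** * Detecting a component along each summand *)

Lemma e2_notin {c1 c2 c3 c4 c5 c6} : W2comb c1 c2 c3 c4 c5 c6 \in I ->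
  e2 v \notin I -> [/\ c1 = 0, c2 = 0, c3 = 0 & c4 = 0].
Proof.
move=> cI e2I.
have coef0 b1 b2 b3 b4 b5 b6 : W2comb b1 b2 b3 b4 b5 b6 \in I -> b2 = 0.
  move/proj2_in => bI; apply/eqP; apply: contraNT e2I => b_neq0.
  have := memvZ b2^-1 bI; rewrite W2combZ mulr0 mulVf //.
  by rewrite /W2comb scale1r !scale0r !addr0 add0r.
(* Lowering sends [e4] to [e3], [e3] to [2 e1] and [e1] to [3 e2], so the [e2] coordinates obtained
   are [3 c1], [6 c3] and [6 c4]. *)
have := coef0 _ _ _ _ _ _ (lower_in (proj15_in cI)).
have := coef0 _ _ _ _ _ _ (lower_in (lower_in (proj36_in cI))).
have := coef0 _ _ _ _ _ _ (lower_in (lower_in (lower_in (proj4_in cI)))).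
have scale0 (k c : F) : k != 0 -> k * c = 0 -> c = 0.
  by move=> /negPf k0 /eqP; rewrite mulf_eq0 k0 => /eqP.
move=> /(scale0 _ _ three_neq0)/(scale0 _ _ two_neq0) c4_0.
move=> /(scale0 _ _ three_neq0)/(scale0 _ _ two_neq0) c3_0.
by move=> /(scale0 _ _ three_neq0) c1_0; split=> //; apply: coef0 cI.
Qed.

(** Weights alone do not separate [e5] from [e1], both of weight -1; raising followed by lowering
    does, having distinct eigenvalues on them. *)
Lemma e5_notin {c1 c2 c3 c4 c5 c6} : W2comb c1 c2 c3 c4 c5 c6 \in I ->
  e5 v \notin I -> c5 = 0 /\ c6 = 0.
Proof.
move=> cI e5I.
have coef0 b1 b2 b3 b4 b5 b6 : W2comb b1 b2 b3 b4 b5 b6 \in I -> b5 = 0.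
  move/proj15_in => bI; apply/eqP; apply: contraNT e5I => b_neq0.
  (* Raising then lowering acts as 4 on [e1] and as 1 on [e5]. *)
  have := memvZ (3 * b5)^-1
    (memvD (memvZ 4 bI) (memvZ (- 1) (lower_in (raise_in bI)))).
  rewrite !W2combZ W2combD W2combZ.
  move/(W2comb_in_eq 0 0 0 0 1 0).
  rewrite /W2comb scale1r !scale0r !add0r addr0.
  by apply; field; rewrite ?three_neq0 ?b_neq0.
split; first exact: coef0 cI.
(* Lowering sends [e6] to [- e5]. *)
by apply/eqP; rewrite -oppr_eq0 (coef0 _ _ _ _ _ _ (lower_in (proj36_in cI))).
Qed.

(** * Generation of the summands and the resulting inclusions *)

Lemma e2_generates : e2 v \in I ->
  (<<[:: e1 v; e2 v; e3 v; e4 v]>> <= I)%VS.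
Proof.
move=> e2I.
have W2comb2 : W2comb 0 1 0 0 0 0 \in I.
  by rewrite /W2comb scale1r !scale0r !addr0 add0r.
(* Raising sends [e2] to [e1], then to [2 e3], then to [6 e4]; 2 and 6 are invertible. *)
have e1I := raise_in W2comb2; have e3I := raise_in e1I.
have e4I := raise_in e3I.
have {}e1I : e1 v \in I.
  move/(W2comb_in_eq 1 0 0 0 0 0): e1I.
  by rewrite /W2comb scale1r !scale0r !addr0; apply; ring.
have {}e3I : e3 v \in I.
  move/(memvZ 2^-1): e3I; rewrite W2combZ => /(W2comb_in_eq 0 0 1 0 0 0).
  by rewrite /W2comb scale1r !scale0r !addr0 !add0r; apply; field.
have {}e4I : e4 v \in I.
  move/(memvZ 6^-1): e4I; rewrite W2combZ => /(W2comb_in_eq 0 0 0 1 0 0).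
  by rewrite /W2comb scale1r !scale0r !addr0 !add0r; apply; field.
by apply/span_subvP; apply/allP; rewrite /= e1I e2I e3I e4I.
Qed.

Lemma e5_generates : e5 v \in I -> (<<[:: e5 v; e6 v]>> <= I)%VS.
Proof.
move=> e5I.
have W2comb5 : W2comb 0 0 0 0 1 0 \in I.
  by rewrite /W2comb scale1r !scale0r !add0r addr0.
have e6I : e6 v \in I.
  move/(memvZ (- 1)): (raise_in W2comb5).
  rewrite W2combZ => /(W2comb_in_eq 0 0 0 0 0 1).
  by rewrite /W2comb scale1r !scale0r !add0r; apply; ring.
by apply/span_subvP; apply/allP; rewrite /= e5I e6I.
Qed.

Lemma sub_span_e1234 : e5 v \notin I ->
  (I <= <<[:: e1 v; e2 v; e3 v; e4 v]>>)%VS.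
Proof.
move=> e5I; apply/subvP => w wI.
have [c1 [c2 [c3 [c4 [c5 [c6 w_eq]]]]]] := W2_inP _ (subvP I_ideal.1 w wI).
rewrite w_eq in wI *; have [-> ->] := e5_notin wI e5I.
rewrite /W2comb !scale0r !addr0.
by repeat apply: memvD; apply: memvZ; apply: memv_span;
  rewrite !inE eqxx ?orbT.
Qed.

Lemma sub_span_e56 : e2 v \notin I -> (I <= <<[:: e5 v; e6 v]>>)%VS.
Proof.
move=> e2I; apply/subvP => w wI.
have [c1 [c2 [c3 [c4 [c5 [c6 w_eq]]]]]] := W2_inP _ (subvP I_ideal.1 w wI).
rewrite w_eq in wI *; have [-> -> -> ->] := e2_notin wI e2I.
rewrite /W2comb !scale0r !add0r.
by apply: memvD; apply: memvZ; apply: memv_span; rewrite !inE eqxx ?orbT.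
Qed.

Lemma left_ideal_eq0 : e2 v \notin I -> e5 v \notin I -> I = 0%VS.
Proof.
move=> e2I e5I; apply/eqP; rewrite -subv0; apply/subvP => w wI.
have [c1 [c2 [c3 [c4 [c5 [c6 w_eq]]]]]] := W2_inP _ (subvP I_ideal.1 w wI).
rewrite w_eq in wI *.
have [-> -> -> ->] := e2_notin wI e2I.
have [-> ->] := e5_notin wI e5I.
by rewrite /W2comb !scale0r !addr0 mem0v.
Qed.

Lemma left_ideal_eqW2 : e2 v \in I -> e5 v \in I -> I = W2 v.
Proof.
move=> e2I e5I; apply/eqP; rewrite eqEsubv I_ideal.1 /=.
rewrite /W2 -[X in span X]/([:: e1 v; e2 v; e3 v; e4 v] ++ [:: e5 v; e6 v]).
by rewrite span_cat subv_add e2_generates ?e5_generates.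
Qed.

End LeftIdeal.
End PlaneBilinearMaps.

Theorem lemma4 (F : fieldType) (charF0 : [pchar F] =i pred0)
    (V : vectType F) (v : 2.-tuple V) (v_basis : basis_of fullv v)
    (I : {vspace bilmap V}) :
  nontrivial_left_ideal v (W2 v) I ->
  I = <<[:: e1 v; e2 v; e3 v; e4 v]>>%VS \/ I = <<[:: e5 v; e6 v]>>%VS.
Proof.
case=> I_ideal I_neq0 I_neqW.
(* Membership of [e2] and [e5] decides which summands [I] contains; the cases give [W2], the first
   summand, the second and 0. *)
have [e2I | e2I] := boolP (e2 v \in I); have [e5I | e5I] := boolP (e5 v \in I).
- by case: I_neqW; apply: left_ideal_eqW2.
- left; apply/eqP; rewrite eqEsubv sub_span_e1234 //=.
  exact: e2_generates.
- right; apply/eqP; rewrite eqEsubv sub_span_e56 //=.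
  exact: e5_generates.
- by case: I_neq0; apply: (@left_ideal_eq0 F V v).
Qed.
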